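(* Let $n\ge 3$ and let $p(z)=\prod_{i=1}^n(z-z_i)\in S_n$, with the zeros labeled so that $|p|_{a}=d(p)$, where $a=z_1$. Assume that both $p$ and $p'$ have only simple zeros and that $|p|_{z_i}<d(p)$ for $2\le i\le n$. Then $p$ is linearly inextensible if and only if the matrix $A(p;a)$ is positively singular.
   Context: $S_n$ is the set of monic complex polynomials of degree $n$ with all zeros in the closed unit disk, and $Z(p)$ denotes the zero set of $p$. For $\alpha\in\mathbb{C}$, $|p|_\alpha=\min_{w\in Z(p')}|\alpha-w|$, and $d(p)=\max_{z\in Z(p)}|p|_z$. For monic $p(z)=\prod_{i=1}^n(z-z_i)$ and $q(z)=\prod_{i=1}^n(z-\zeta_i)$, $\Delta(p,q)=\min_{\sigma\in\Sigma_n}\max_{1\le i\le n}|z_i-\zeta_{\sigma(i)}|$, where $\Sigma_n$ is the symmetric group. A polynomial $p\in S_n$ is linearly inextensible if there exist $\varepsilon>0$ and constants $C\ge 0$, $\kappa>0$ depending only on $p$ such that $d(q)\le d(p)+C\,\Delta(q,p)^{1+\kappa}$ for all $q\in S_n$ with $\Delta(q,p)<\varepsilon$. A complex $m\times n$ matrix $(m_{ij})$ is positively singular if there exist real $\mu_1,\dots,\mu_m\ge 0$, not all $0$, such that $\sum_{i=1}^m\mu_i m_{ij}=0$ for $1\le j\le n$. Definition of $A(p;a)$: let $p'(z)=n\prod_{j=1}^{n-1}(z-w_j)$, with the $w_j$ labeled so that $|w_j-a|=|p|_a$ for $1\le j\le r$ and $|w_j-a|>|p|_a$ for $j\ge r+1$,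 where $r=r(a)\in\{1,\dots,n-1\}$. Let $1\le s_1<\dots<s_m\le n$ be the indices $i$ for which $|z_i|=1$ (so $|z_i|<1$ for all other $i$). For $1\le j\le r$ put $$\alpha_1(w_j;a)=-\frac{1}{w_j-a}\left[1+\frac{p(w_j)}{(w_j-a)^2p''(w_j)}\right],\qquad \alpha_i(w_j;a)=-\frac{p(w_j)}{(w_j-a)(w_j-z_i)^2p''(w_j)},\quad 2\le i\le n.$$ Then $A(p;a)=(a_{ij})$ is the $(r+m)\times n$ matrix with $a_{ij}=\alpha_j(w_i;a)$ for $1\le i\le r$, $1\le j\le n$; $a_{ij}=-\overline{z}_{s_k}$ if $i=r+k$ and $j=s_k$ for $1\le k\le m$; and $a_{ij}=0$ otherwise. *)

(* Defs.v *)
From HB Require Import structures.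
From mathcomp Require Export all_boot all_order all_algebra all_fingroup.
From mathcomp Require Export all_reals exp.
From mathcomp Require Export complex.
Export Order.TTheory GRing.Theory Num.Theory.

Set Implicit Arguments.
Unset Strict Implicit.
Unset Printing Implicit Defensive.

Local Open Scope ring_scope.
Local Open Scope complex_scope.

(* The R-valued modulus; `|x| on R[i] is R[i]-valued. *)
Notation cabs := ComplexField.Normc.normc.

Section Definitions.
Variable R : realType.
Local Notation C := R[i].
Implicit Types (p q : {poly C}) (a w x : C).

(* The zeros of p <> 0 listed with multiplicity, in an unspecified order. *)
Definition zeros p : seq C := sval (closed_field_poly_normal p).

Lemma zerosE p : p = lead_coef p *: \prod_(x <- zeros p) ('X - x%:P).
Proof. exact: svalP (closed_field_poly_normal p). Qed.

Definition inS (n : nat) p : Prop :=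
  [/\ p \is monic, size p = n.+1 & forall x, root p x -> cabs x <= 1].

(* |p|_a; meaningful when p has degree >= 2, so that p^`() has a zero. The
   idx of the iterated minimum is one of the values being minimized. *)
Definition critdist p a : R :=
  \big[Num.min/cabs (a - (zeros p^`())`_0)]_(w <- zeros p^`()) cabs (a - w).

(* The idx 0 is harmless since all the values are nonnegative. *)
Definition maxdist p : R := \big[Num.max/0]_(x <- zeros p) critdist p x.

Definition matchdist (n : nat) p q (sigma : 'S_n) : R :=
  \big[Num.max/0]_(i < n) cabs ((zeros p)`_i - (zeros q)`_(sigma i)).

(* Delta(p, q) for p and q of degree n; it does not depend on the order in
   which the zeros are listed. *)
Definition Delta (n : nat) p q : R :=
  \big[Num.min/matchdist p q (1%g : 'S_n)]_(sigma : 'S_n) matchdist p q sigma.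

Definition linearly_inextensible (n : nat) p : Prop :=
  exists eps Cst kappa : R,
    [/\ 0 < eps, 0 <= Cst, 0 < kappa &
        forall q, inS n q -> Delta n q p < eps ->
          maxdist q <= maxdist p + Cst * (Delta n q p `^ (1 + kappa))].

Definition positively_singular (m n : nat) (M : 'M[C]_(m, n)) : Prop :=
  exists mu : 'I_m -> R,
    [/\ forall i, 0 <= mu i,
        exists i, mu i != 0 &
        forall j : 'I_n, \sum_(i < m) (mu i)%:C * M i j = 0].

Definition simple_zeros p : Prop := forall x, root p x -> mup x p = 1%N.

(* Zeros and critical points are indexed from 0: z`_0 is the distinguished
   zero, and the first r entries of w are the critical points nearest to it. *)
Definition alpha p (z : seq C) w (i : nat) : C :=
  let a := z`_0 in
  if i == 0%N
  then - (w - a)^-1 * (1 + p.[w] / ((w - a) ^+ 2 * p^`(2).[w]))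
  else - (p.[w] / ((w - a) * (w - z`_i) ^+ 2 * p^`(2).[w])).

Definition unimodular (n : nat) (z : n.-tuple C) : {set 'I_n} :=
  [set i : 'I_n | cabs z`_i == 1].

(* The elements of unimodular z are enumerated increasingly by enum_val. *)
Definition Amatrix (n r : nat) p (z : n.-tuple C) (w : seq C) :
    'M[C]_(r + #|unimodular z|, n) :=
  col_mx
    (\matrix_(i < r, j < n) alpha p z w`_i j)
    (\matrix_(k < #|unimodular z|, j < n)
       if j == enum_val k then - conjc z`_j else 0).

Definition labels_zeros (n : nat) p (z : n.-tuple C) : Prop :=
  p = \prod_(i < n) ('X - (z`_i)%:P).

Definition labels_critical_points (n r : nat) p a (w : n.-1.-tuple C) : Prop :=
  [/\ p^`() = n%:R *: \prod_(j < n.-1) ('X - (w`_j)%:P),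
      (0 < r < n)%N,
      forall j : 'I_n.-1, (j < r)%N -> cabs (w`_j - a) = critdist p a &
      forall j : 'I_n.-1, (r <= j)%N -> critdist p a < cabs (w`_j - a)].

End Definitions.

(* Main.v *)
(* Move the zeros of p by a small vector h. A simple critical point w_j moves by a
   linear function of h up to O(|h|^2), and dlog w_j h, the pairing of h with a row
   of A(p; a), is the relative first order change of w_j - a. Hence near p the
   distance |p|_a varies, up to O(|h|^2), like the minimum over j <= r of
   d(p) (1 + Re (A h)_j), while staying in the unit disk forces Re (A h)_i >= 0
   on the remaining rows. If A is positively singular, a nonnegative combination
   of all the rows vanishes, so Re (A h)_j <= 0 for some j <= r. If it is not,
   Gordan's theorem gives h with Re (A h)_i > 0 for all i, and moving the zeros
   along t h increases d linearly in t. *)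
Require Import Defs.
From mathcomp Require Import ring lra boolp.

Set Implicit Arguments.
Unset Strict Implicit.
Unset Printing Implicit Defensive.

Local Open Scope ring_scope.
Local Open Scope complex_scope.

(** * The real-valued modulus of a complex number *)

Section Modulus.
Variable R : realType.
Local Notation Re := (@complex.Re R).
Local Notation Im := (@complex.Im R).
Implicit Types (x y : R[i]) (t : R).

Lemma cabs_ge0 x : 0 <= cabs x.
Proof. by case: x => a b; rewrite sqrtr_ge0. Qed.

Lemma cabs_eq0 x : (cabs x == 0) = (x == 0).
Proof.
apply/eqP/eqP => [/ComplexField.Normc.eq0_normc //|->].
exact: ComplexField.Normc.normc0.
Qed.

Lemma cabs_gt0 x : (0 < cabs x) = (x != 0).
Proof. by rewrite lt0r cabs_eq0 cabs_ge0 andbT. Qed.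

Lemma cabsM x y : cabs (x * y) = cabs x * cabs y.
Proof. exact: ComplexField.Normc.normcM. Qed.

Lemma cabsV x : cabs x^-1 = (cabs x)^-1.
Proof. exact: ComplexField.Normc.normcV. Qed.

Lemma cabsN x : cabs (- x) = cabs x.
Proof. exact: normcN. Qed.

Lemma cabsBC x y : cabs (x - y) = cabs (y - x).
Proof. by rewrite -cabsN opprB. Qed.

Lemma ler_cabsD x y : cabs (x + y) <= cabs x + cabs y.
Proof. exact: le_normcD. Qed.

Lemma ler_cabsB x y : cabs x - cabs y <= cabs (x - y).
Proof. by rewrite lerBlDr; apply: le_trans (ler_cabsD _ _); rewrite subrK. Qed.

Lemma ler_cabs_dist x y z : cabs (x - z) <= cabs (x - y) + cabs (y - z).
Proof. by apply: le_trans (ler_cabsD _ _); rewrite addrA subrK. Qed.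

Lemma cabs_real t : cabs t%:C = `|t|.
Proof. by rewrite /= expr0n addr0 sqrtr_sqr. Qed.

Lemma ler_cabs_sum (I : Type) (r : seq I) (F : I -> R[i]) :
  cabs (\sum_(i <- r) F i) <= \sum_(i <- r) cabs (F i).
Proof.
elim/big_rec2: _ => [|i s x _ le_xs]; first by rewrite ComplexField.Normc.normc0.
by apply: le_trans (ler_cabsD _ _) _; rewrite lerD2l.
Qed.

Lemma sqr_cabs x : cabs x ^+ 2 = Re x ^+ 2 + Im x ^+ 2.
Proof. by case: x => a b /=; rewrite sqr_sqrtr // addr_ge0 ?sqr_ge0. Qed.

Lemma Re_le_cabs x : `|Re x| <= cabs x.
Proof. by case: x => a b /=; rewrite -sqrtr_sqr ler_wsqrtr // lerDl sqr_ge0. Qed.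

Lemma Re_sum (I : Type) (r : seq I) (F : I -> R[i]) :
  Re (\sum_(i <- r) F i) = \sum_(i <- r) Re (F i).
Proof. exact: (raddf_sum (@complex.Re R : {additive R[i] -> R})). Qed.

Lemma ReD x y : Re (x + y) = Re x + Re y.
Proof. by case: x y => [a b] [c d]. Qed.

Lemma Re_scale t x : Re (t%:C * x) = t * Re x.
Proof. by case: x => a b /=; rewrite mul0r subr0. Qed.

Lemma cabs_addl1_ge x : 1 + Re x <= cabs (1 + x).
Proof. by apply: le_trans (Re_le_cabs (1 + x)); rewrite ReD ler_norm. Qed.

(** Put a = Re x and c = |x|. The square of the right side exceeds |1 + x|^2 by a^2 + (1 + 2a) c^2 +
    c^4, and 1 + 2a >= 0 because |a| <= c <= 1/2. *)
Lemma cabs_addl1_le x : cabs x <= 2^-1 -> cabs (1 + x) <= 1 + Re x + cabs x ^+ 2.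
Proof.
move=> hx; have := Re_le_cabs x; rewrite ler_norml => /andP[h1 h2].
rewrite -ler_sqr ?nnegrE ?cabs_ge0 //; last by have := sqr_ge0 (cabs x); lra.
rewrite (sqr_cabs (1 + x)) ReD.
have -> : Im (1 + x) = Im x by case: x {hx h1 h2} => a b /=; rewrite add0r.
have := sqr_cabs x; set c := cabs x; set a := Re x; set b := Im x => hc.
rewrite -/a (_ : complex.Re 1 = 1) //.
have s0 := sqr_ge0 c; have b0 := sqr_ge0 b.
have : 0 <= (1 + 2 * a) * c ^+ 2 by rewrite mulr_ge0 //; lra.
have : 0 <= (c ^+ 2) ^+ 2 by rewrite sqr_ge0.
by move: hc s0 b0; set s := c ^+ 2; nra.
Qed.

End Modulus.

(** * Logarithmic derivatives of products of linear factors *)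

Section LogarithmicDerivatives.
Variables (F : fieldType) (I : eqType) (u : I -> F) (x : F).

Lemma deriv_prod_XsubC (r : seq I) : {in r, forall i, x != u i} ->
  (\prod_(i <- r) ('X - (u i)%:P))^`().[x] =
  (\prod_(i <- r) ('X - (u i)%:P)).[x] * \sum_(i <- r) (x - u i)^-1.
Proof.
elim: r => [|i r IH] hx; first by rewrite !big_nil derivC horner0 mulr0.
have hi : x - u i != 0 by rewrite subr_eq0 hx ?mem_head.
rewrite !big_cons derivM derivXsubC mul1r hornerD !hornerM hornerXsubC.
by rewrite IH => [|j hj]; [field | rewrite hx // inE hj orbT].
Qed.

(** This is P''/P = (P'/P)^2 + (P'/P)', where P'/P is the sum of the 1/(x - u_i). *)
Lemma deriv2_prod_XsubC (r : seq I) : {in r, forall i, x != u i} ->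
  (\prod_(i <- r) ('X - (u i)%:P))^`(2).[x] =
  (\prod_(i <- r) ('X - (u i)%:P)).[x] *
  ((\sum_(i <- r) (x - u i)^-1) ^+ 2 - \sum_(i <- r) (x - u i)^-1 ^+ 2).
Proof.
elim: r => [|i r IH] hx.
  by rewrite !big_nil !derivnS derivn0 !(derivC, horner0) expr0n subr0 mulr0.
have hr : {in r, forall i, x != u i} by move=> j hj; rewrite hx // inE hj orbT.
have hi : x - u i != 0 by rewrite subr_eq0 hx ?mem_head.
move: (IH hr) (deriv_prod_XsubC hr) => {}IH IH1.
rewrite !big_cons !derivnS derivn0 derivM derivXsubC mul1r derivD derivM.
rewrite derivXsubC mul1r !hornerD !hornerM hornerXsubC.
by move: IH; rewrite !derivnS derivn0 => ->; rewrite IH1; field.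
Qed.

End LogarithmicDerivatives.

(** * Zeros, distances to critical points and the matching distance *)

Section PolynomialZeros.
Variable R : realType.
Local Notation C := R[i].
Implicit Types (p q : {poly C}) (a x : C).

Lemma mem_zeros p x : p != 0 -> (x \in zeros p) = root p x.
Proof.
by move=> p0; rewrite {2}(zerosE p) rootZ ?lead_coef_eq0 // root_prod_XsubC.
Qed.

Lemma size_zeros p : p != 0 -> size (zeros p) = (size p).-1.
Proof.
by move=> p0; rewrite {2}(zerosE p) size_scale ?lead_coef_eq0 // size_prod_XsubC.
Qed.

(* From p'(x)/p(x) = \sum 1/(x - v): the nearest zero is no farther than deg p
   times the Newton step. *)
Lemma exists_near_root p x : p^`().[x] != 0 ->
  exists2 v, root p v & cabs (x - v) * cabs p^`().[x] <= (size p).-1%:R * cabs p.[x].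
Proof.
move=> hp'; have p0 : p != 0 by apply: contraNneq hp' => ->; rewrite derivC horner0.
have [px|px] := boolP (root p x).
  by exists x => //; rewrite subrr ComplexField.Normc.normc0 mul0r mulr_ge0 ?cabs_ge0.
rewrite -size_zeros //; set s := zeros p.
have hx : {in s, forall v : C, x != v}.
  by move=> v; apply: contraTneq => <-; rewrite mem_zeros.
have dp : p^`().[x] = p.[x] * \sum_(v <- s) (x - v)^-1.
  have := deriv_prod_XsubC (u := id) hx; set P := \prod_(v <- s) _ => dP.
  by rewrite (zerosE p) -/s -/P derivZ !hornerZ dP mulrA.
(* If every zero violated the bound, each term of p'(x) = p(x) \sum 1/(x - v) would have modulus
   below |p'(x)| / deg p. Summing gives |p'(x)| < |p'(x)|; strictness requires at least one zero. *)
case: (boolP (has (fun v => cabs (x - v) * cabs p^`().[x] <=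
    (size s)%:R * cabs p.[x]) s)) => [/hasP[v vs hv]|/hasPn hs].
  by exists v; rewrite -?mem_zeros.
have s_gt0 : 0 < (size s)%:R :> R.
  rewrite ltr0n lt0n; apply: contraNneq hp' => /size0nil s0.
  by rewrite dp s0 big_nil mulr0.
have {}hs v : v \in s -> cabs p.[x] * (cabs (x - v))^-1 < (size s)%:R^-1 * cabs p^`().[x].
  move=> vs; have := hs _ vs; rewrite -ltNge => h.
  have xv : 0 < cabs (x - v) by rewrite cabs_gt0 subr_eq0 hx.
  by rewrite ltr_pdivrMr // -mulrA ltr_pdivlMl // [X in _ < X]mulrC.
have : cabs p^`().[x] < cabs p^`().[x]; last by rewrite ltxx.
rewrite {1}dp cabsM; apply: le_lt_trans (ler_wpM2l (cabs_ge0 _) (ler_cabs_sum _ _)) _.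
have -> : cabs p^`().[x] = \sum_(v <- s) (size s)%:R^-1 * cabs p^`().[x].
  rewrite big_const_seq count_predT iter_addr_0 -[RHS]mulr_natl mulrA divff ?mul1r //.
  by rewrite lt0r_neq0.
rewrite mulr_sumr big_seq [X in _ < X]big_seq; apply: ltr_sum.
  by case: (s) s_gt0 => [|v s' _]; [rewrite ltxx | rewrite /= mem_head].
by move=> v vs; rewrite cabsV hs.
Qed.

Lemma perm_zeros (I : Type) (r : seq I) (u : I -> C) :
  perm_eq (zeros (\prod_(i <- r) ('X - (u i)%:P))) [seq u i | i <- r].
Proof.
rewrite prod_XsubC_eq // big_map.
set p := \prod_(i <- r) _; have /monicP p1 : p \is monic by apply: monic_prod_XsubC.
by rewrite {2}(zerosE p) p1 scale1r.
Qed.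

Lemma size_deriv p : size p^`() = (size p).-1.
Proof.
have [p1|p1] := leqP (size p) 1.
  by rewrite {1}(size1_polyC p1) derivC size_poly0; case: (size p) p1 => [|[]].
rewrite size_poly_eq // mulrn_eq0 -subn2 -subSn // subn2 /=.
by rewrite negb_or -lead_coefE lead_coef_eq0 -size_poly_eq0; case: (size p) p1 => [|[]].
Qed.

Lemma critdist_le p a x : p^`() != 0 -> root p^`() x -> critdist p a <= cabs (a - x).
Proof. by move=> p0 px; apply: bigmin_inf_seq (lexx _) => //; rewrite mem_zeros. Qed.

Lemma critdist_attained p a : (2 < size p)%N ->
  exists2 x, root p^`() x & critdist p a = cabs (a - x).
Proof.
move=> hp; have hp' : (0 < (size p^`()).-1)%N.
  by rewrite size_deriv; case: (size p) hp => [|[|[]]].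
have p0 : p^`() != 0 by rewrite -size_poly_eq0; case: (size _) hp'.
have h0 : (zeros p^`())`_0 \in zeros p^`() by rewrite mem_nth // size_zeros.
rewrite /critdist big_seq; elim/big_ind: _ => [|_ _ [x hx ->] [y hy ->]|x hx].
- by exists (zeros p^`())`_0; rewrite -?mem_zeros.
- by case: (leP (cabs (a - x)) (cabs (a - y))) => _; [exists x | exists y].
- by exists x; rewrite -?mem_zeros.
Qed.

Lemma maxdist_ge p x : p != 0 -> root p x -> critdist p x <= maxdist p.
Proof. by move=> p0 px; apply: bigmax_sup_seq (lexx _) => //; rewrite mem_zeros. Qed.

Lemma maxdist_le p (d : R) : p != 0 -> 0 <= d ->
  (forall x, root p x -> critdist p x <= d) -> maxdist p <= d.
Proof.
move=> p0 d0 hd; rewrite /maxdist big_seq_cond bigmax_le // => x.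
by rewrite andbT mem_zeros // => /hd.
Qed.

Lemma matchdist_ge n p q (s : 'S_n) (i : 'I_n) :
  cabs ((zeros p)`_i - (zeros q)`_(s i)) <= matchdist p q s.
Proof. exact: bigmax_sup (lexx _). Qed.

Lemma Delta_attained n p q : exists s : 'S_n, Delta n p q = matchdist p q s.
Proof.
rewrite /Delta; elim/big_ind: _ => [|_ _ [s ->] [t ->]|s _].
- by exists 1%g.
- by case: (leP (matchdist p q s) (matchdist p q t)) => _; [exists s | exists t].
- by exists s.
Qed.

Lemma Delta_ge0 n p q : 0 <= Delta n p q.
Proof.
by case: (Delta_attained n p q) => s ->; apply: bigmax_ge_id.
Qed.

(** The order chosen by [zeros] is unspecified; the permutation [s] translates it into a given
    labelling. *)
Lemma zeros_labelled n (u : 'I_n -> C) : exists s : 'S_n, forall i : 'I_n,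
  (zeros (\prod_(j < n) ('X - (u j)%:P)))`_i = u (s i).
Proof.
have /tuple_permP[s hs] : perm_eq (zeros (\prod_(j < n) ('X - (u j)%:P)))
    [tuple u i | i < n].
  rewrite (permPl (perm_zeros _ _)) perm_map // uniq_perm ?index_enum_uniq //.
    exact: enum_uniq.
  by move=> i; rewrite mem_index_enum mem_enum.
exists s => i; rewrite hs (nth_map i) ?size_enum_ord // nth_ord_enum.
by rewrite tnth_mktuple.
Qed.

Lemma Delta_le n (u v : 'I_n -> C) (d : R) : 0 <= d ->
  (forall i, cabs (u i - v i) <= d) ->
  Delta n (\prod_(i < n) ('X - (u i)%:P)) (\prod_(i < n) ('X - (v i)%:P)) <= d.
Proof.
move=> d0 hd.
have [su hsu] := zeros_labelled u; have [sv hsv] := zeros_labelled v.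
(* Entry i of the first list is u (su i). Applying [sv^-1] after [su] pairs it with v (su i). *)
apply: bigmin_inf (_ : matchdist _ _ (su * sv^-1)%g <= d) => //.
by rewrite bigmax_le // => i _; rewrite hsu hsv permM permKV.
Qed.

(** An optimal matching turns closeness in [Delta] into a displacement of labelled zeros, the form
    in which perturbations are analysed below. *)
Lemma Delta_shift n p (u : 'I_n -> C) : size p = n.+1 -> p \is monic ->
  exists h : 'I_n -> C, p = \prod_(i < n) ('X - (u i + h i)%:P) /\
    forall i, cabs (h i) <= Delta n p (\prod_(i < n) ('X - (u i)%:P)).
Proof.
move=> sp p1; set q := \prod_(i < n) ('X - (u i)%:P).
have p0 : p != 0 by rewrite monic_neq0.
have [s hs] := Delta_attained n p q.
have [t ht] := zeros_labelled u.
(* The matching [s] pairs entry i of [zeros p] with u (t (s i)), so u_i moves to the entry of index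
   (s * t)^-1 i. *)
exists (fun i => (zeros p)`_((s * t)^-1 i)%g - u i); split; last first.
  move=> i; rewrite hs; apply: le_trans (matchdist_ge _ _ _ ((s * t)^-1 i)%g).
  by rewrite ht -(permM s t) permKV.
rewrite {1}(zerosE p) (monicP p1) scale1r (big_nth 0) size_zeros // sp /=.
rewrite big_mkord (reindex_inj (@perm_inj _ (s * t)^-1%g)) /=.
by apply: eq_bigr => i _; rewrite [u i + _]addrC subrK.
Qed.

End PolynomialZeros.

(** * Gordan's theorem *)

Section Gordan.
Variable R : realFieldType.

(** With S the sum of all |b_i| / a_i, the choice e = 1/(1 + S) gives e |b_i| < a_i for every i at
    once; the summand 1 keeps the divisor positive. *)
Lemma exists_small_pos (I : finType) (a b : I -> R) : (forall i, 0 < a i) ->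
  exists2 e, 0 < e & forall i, 0 < a i + e * b i.
Proof.
move=> a_gt0; pose S := \sum_i `|b i| / a i.
have F0 i : 0 <= `|b i| / a i by rewrite divr_ge0 // ltW.
have S0 : 0 < 1 + S by rewrite ltr_pwDl // sumr_ge0.
exists (1 + S)^-1 => [|i]; first by rewrite invr_gt0.
have : `|b i| < a i * (1 + S).
  rewrite mulrC -ltr_pdivrMr // /S (bigD1 i) //= addrCA ltrDl.
  by rewrite ltr_pwDl // sumr_ge0.
rewrite -ltr_pdivrMr // => h; have := ler_norm (- b i); rewrite normrN => h2.
rewrite mulrC -[X in 0 < _ + X]opprK subr_gt0 -mulNr; apply: le_lt_trans h.
by rewrite ler_pM2r ?invr_gt0.
Qed.

(* Induction on the number of functionals. If x is positive on all but the first
   functional g and g x < 0, subtract multiples of g from the others to make them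
   vanish at x. *)
Lemma gordan (V : lmodType R) (m : nat) (f : 'I_m -> V -> R) :
  (forall i s x y, f i (x + s *: y) = f i x + s * f i y) ->
  (exists mu : 'I_m -> R, [/\ forall i, 0 <= mu i, exists i, mu i != 0 &
     forall x, \sum_i mu i * f i x = 0]) \/
  exists x, forall i, 0 < f i x.
Proof.
elim: m f => [|m IH] f f_lin; first by right; exists 0 => -[].
pose extend (c : R) (mu : 'I_m -> R) i :=
  if unlift ord0 i is Some j then mu j else c.
have extend0 c mu : extend c mu ord0 = c by rewrite /extend unlift_none.
have extendS c mu j : extend c mu (lift ord0 j) = mu j by rewrite /extend liftK.
have [[mu [mu0 [j muj] sum0]]|[x x_pos]] := IH _ (fun j => f_lin (lift ord0 j)).
  left; exists (extend 0 mu); split=> [i||x].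
  - by case: (unliftP ord0 i) => [k|] ->; rewrite ?extend0 ?extendS.
  - by exists (lift ord0 j); rewrite extendS.
  - rewrite big_ord_recl extend0 mul0r add0r -[RHS](sum0 x).
    by apply: eq_bigr => k _; rewrite extendS.
have lift_pos (y : V) : 0 < f ord0 y -> (forall j, 0 < f (lift ord0 j) y) ->
    exists x, forall i, 0 < f i x.
  by move=> h0 hj; exists y => i; case: (unliftP ord0 i) => [k|] ->.
have [g0|g0|g0] := ltgtP (f ord0 x) 0; last 1 first.
(* Case g x = 0. If g y <> 0, then g takes the positive value (g y)^2 at y' = g(y) y, and x + e y'
   works for small e. If g vanishes identically, weight 1 on g alone gives a singular
   combination. *)
- have [[y hy]|g_eq0] := pselect (exists y, f ord0 y != 0).
    right; pose y' := f ord0 y *: y.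
    have [e e0 he] := exists_small_pos (fun j => f (lift ord0 j) y') x_pos.
    apply: (lift_pos (x + e *: y')) => [|j]; rewrite f_lin ?he // g0 add0r.
    have -> : f ord0 y' = f ord0 y * f ord0 y.
      have := f_lin ord0 (f ord0 y) 0 y; rewrite add0r => ->.
      have := f_lin ord0 1 0 0; rewrite scale1r add0r mul1r => h.
      have -> : f ord0 0 = 0 by lra.
      by rewrite add0r.
    by rewrite mulr_gt0 // -expr2 exprn_even_gt0.
  left; exists (extend 1 (fun=> 0)); split=> [i||y].
  - by case: (unliftP ord0 i) => [k|] ->; rewrite ?extend0 ?extendS.
  - by exists ord0; rewrite extend0 oner_neq0.
  rewrite big_ord_recl big1 => [|k _]; last by rewrite extendS mul0r.
  rewrite extend0 mul1r addr0; apply/eqP; case: eqP => // /eqP hy.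
  by case: g_eq0; exists y.
(* Case g x < 0. The functionals b_j vanish at x. Weights [mu] for them become weights for f, and
   the resulting weight of g is nonnegative since f_j x > 0 > g x. *)
- pose b j y := f (lift ord0 j) y - f (lift ord0 j) x / f ord0 x * f ord0 y.
  have g1 : f ord0 x != 0 by rewrite lt_eqF.
  have b_lin j s y y' : b j (y + s *: y') = b j y + s * b j y'.
    by rewrite /b !f_lin; ring.
  have [[mu [mu0 [j muj] sum0]]|[y y_pos]] := IH _ b_lin.
    left; exists (extend (- \sum_j mu j * f (lift ord0 j) x / f ord0 x) mu); split.
    + move=> i; case: (unliftP ord0 i) => [k|] ->; rewrite ?extend0 ?extendS //.
      rewrite -sumrN sumr_ge0 // => k _; rewrite -mulrN -invrN.
      by rewrite divr_ge0 ?mulr_ge0 ?(ltW (x_pos _)) // oppr_ge0 ltW.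
    + by exists (lift ord0 j); rewrite extendS.
    + move=> y; rewrite big_ord_recl extend0 -[RHS](sum0 y) mulNr mulr_suml -sumrN.
      by rewrite -big_split /=; apply: eq_bigr => k _; rewrite extendS /b; ring.
  (* Adding a multiple of x to y leaves each b_j unchanged. The multiple is chosen so that g becomes
     e, which turns f_j into b_j y + e f_j x / g x. *)
  right; have [e e0 he] := exists_small_pos (fun j => f (lift ord0 j) x / f ord0 x) y_pos.
  apply: (lift_pos (y + (e - f ord0 y) / f ord0 x *: x)) => [|j]; rewrite f_lin.
    by rewrite divfK // addrC subrK.
  by have := he j; rewrite /b; congr (0 < _); field.
- by right; apply: lift_pos g0 x_pos.
Qed.

End Gordan.

(** * Uniform bounds and asymptotic estimates near zero *)

Lemma fin_bound (R : realFieldType) (I : finType) (P : I -> R -> Prop) :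
  (forall i k l, k <= l -> P i k -> P i l) ->
  (forall i, exists2 k, 0 <= k & P i k) -> exists2 k, 0 <= k & forall i, P i k.
Proof.
move=> Pmono hP; have [k hk] : exists k : I -> R, forall i, 0 <= k i /\ P i (k i).
  apply: (@fin_all_exists _ _ (fun i (k : R) => 0 <= k /\ P i k)) => i.
  by have [k k0 hk] := hP i; exists k.
exists (\sum_i k i) => [|i]; first by apply: sumr_ge0 => i _; case: (hk i).
apply: Pmono (proj2 (hk i)); rewrite (bigD1 i) //= lerDl.
by apply: sumr_ge0 => j _; case: (hk j).
Qed.

Section Asymptotics.
Variables (R : realType) (T : Type) (N : T -> R).
Hypothesis N_ge0 : forall h, 0 <= N h.
Local Notation C := R[i].
Implicit Types (P Q : T -> Prop) (f g : T -> C) (c : C) (k : nat).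

(** The gauge [N] is kept abstract because two are used: the sup norm of a displacement vector and
    the absolute value of a real parameter along a ray. *)
Definition near0 P := exists2 d, 0 < d & forall h, N h <= d -> P h.

Definition bigO k f :=
  exists2 K, 0 <= K & near0 (fun h => cabs (f h) <= K * N h ^+ k).

Lemma near0S P Q : (forall h, P h -> Q h) -> near0 P -> near0 Q.
Proof. by move=> PQ [d d0 hd]; exists d => // h /hd/PQ. Qed.

Lemma near0I P Q : near0 P -> near0 Q -> near0 (fun h => P h /\ Q h).
Proof.
move=> [d d0 hd] [e e0 he]; exists (Num.min d e); first by rewrite lt_min d0.
by move=> h; rewrite le_min => /andP[/hd ? /he].
Qed.

Lemma near0_forall (I : finType) (P : I -> T -> Prop) :
  (forall i, near0 (P i)) -> near0 (fun h => forall i, P i h).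
Proof.
move=> hP; have : near0 (fun h => forall i, i \in enum I -> P i h).
  elim: (enum I) => [|i s IH]; first by exists 1.
  apply: near0S (near0I (hP i) IH) => h [Pi Ps] j.
  by rewrite inE => /orP[/eqP->|/Ps].
by apply: near0S => h hh i; apply: hh; rewrite mem_enum.
Qed.

Lemma near0_small (K e : R) : 0 < e -> near0 (fun h => K * N h < e).
Proof.
move=> e0; have K0 : 0 < 1 + `|K| by rewrite ltr_pwDl.
exists (e / 2 / (1 + `|K|)); first by rewrite !divr_gt0.
move=> h; rewrite ler_pdivlMr // => hh; apply: le_lt_trans (_ : e / 2 < e); last by lra.
apply: le_trans hh; rewrite mulrC ler_wpM2l //.
by have := ler_norm K; lra.
Qed.

Lemma near0_le1 : near0 (fun h => N h <= 1).
Proof. by exists 1. Qed.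

Lemma bigO_ext k f g : near0 (fun h => f h = g h) -> bigO k f -> bigO k g.
Proof.
move=> fg [K K0 hf]; exists K => //.
by apply: near0S (near0I fg hf) => h [<-].
Qed.

Lemma bigO_leq j k f : (j <= k)%N -> bigO k f -> bigO j f.
Proof.
move=> jk [K K0 hf]; exists K => //; apply: near0S (near0I near0_le1 hf) => h [N1 hh].
by apply: le_trans hh _; rewrite ler_wpM2l // ler_wiXn2l.
Qed.

Lemma bigO_cst c : bigO 0 (fun=> c).
Proof.
exists (cabs c); first exact: cabs_ge0.
by exists 1 => // h _; rewrite expr0 mulr1.
Qed.

Lemma bigOD k f g : bigO k f -> bigO k g -> bigO k (fun h => f h + g h).
Proof.
move=> [K K0 hf] [M M0 hg]; exists (K + M); first by rewrite addr_ge0.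
apply: near0S (near0I hf hg) => h [hK hM]; apply: le_trans (ler_cabsD _ _) _.
by rewrite mulrDl lerD.
Qed.

Lemma bigOM j k f g : bigO j f -> bigO k g -> bigO (j + k) (fun h => f h * g h).
Proof.
move=> [K K0 hf] [M M0 hg]; exists (K * M); first by rewrite mulr_ge0.
apply: near0S (near0I hf hg) => h [hK hM].
by rewrite cabsM exprD mulrACA ler_pM ?cabs_ge0.
Qed.

Lemma bigOZ k c f : bigO k f -> bigO k (fun h => c * f h).
Proof. exact: bigOM (bigO_cst c). Qed.

Lemma bigON k f : bigO k f -> bigO k (fun h => - f h).
Proof.
move=> /(bigOZ (- 1)); apply: bigO_ext; exists 1 => // h _; by rewrite mulN1r.
Qed.

Lemma bigO_sum (I : Type) (r : seq I) k (F : I -> T -> C) :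
  (forall i, bigO k (F i)) -> bigO k (fun h => \sum_(i <- r) F i h).
Proof.
move=> hF; elim: r => [|i r IH].
  exists 0 => //; exists 1 => // h _.
  by rewrite big_nil ComplexField.Normc.normc0 mul0r.
by apply: bigO_ext (bigOD (hF i) IH); exists 1 => // h _; rewrite big_cons.
Qed.

Lemma bigO_fin (I : finType) k (f : I -> T -> C) : (forall i, bigO k (f i)) ->
  exists2 K, 0 <= K & near0 (fun h => forall i, cabs (f i h) <= K * N h ^+ k).
Proof.
move=> hf; have [i a b ab|K K0 hK] := fin_bound _ hf.
  by apply: near0S => h /le_trans; apply; rewrite ler_wpM2r ?exprn_ge0.
by exists K => //; apply: near0_forall.
Qed.

Lemma bigO1_near_half c f : c != 0 -> bigO 1 (fun h => f h - c) ->
  near0 (fun h => cabs c / 2 <= cabs (f h)).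
Proof.
move=> c0 [K K0 hK]; have hc : 0 < cabs c / 2 by rewrite divr_gt0 // cabs_gt0.
apply: near0S (near0I hK (near0_small K hc)) => h [h1 h2].
by have := ler_cabsB c (f h); rewrite cabsBC; rewrite expr1 in h1; lra.
Qed.

Lemma bigO1_near_neq0 c f : c != 0 -> bigO 1 (fun h => f h - c) ->
  near0 (fun h => f h != 0).
Proof.
move=> c0 /(bigO1_near_half c0); apply: near0S => h hh.
by rewrite -cabs_gt0; apply: lt_le_trans hh; rewrite divr_gt0 // cabs_gt0.
Qed.

Lemma bigO_inv c f : c != 0 -> bigO 1 (fun h => f h - c) ->
  bigO 0 (fun h => (f h)^-1).
Proof.
move=> c0 hf; have hc : 0 < cabs c / 2 by rewrite divr_gt0 // cabs_gt0.
exists (cabs c / 2)^-1; first by rewrite invr_ge0 ltW.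
apply: near0S (bigO1_near_half c0 hf) => h hh.
by rewrite expr0 mulr1 cabsV lef_pV2 // posrE (lt_le_trans hc).
Qed.

Lemma bigO1_inv c f : c != 0 -> bigO 1 (fun h => f h - c) ->
  bigO 1 (fun h => (f h)^-1 - c^-1).
Proof.
move=> c0 hf; have h1 := bigOZ (- c^-1) (bigOM (bigO_inv c0 hf) hf).
apply: bigO_ext h1; apply: near0S (bigO1_near_neq0 c0 hf) => h fh0.
by field; rewrite c0.
Qed.

(** The expression equals (l (f - c) - c (f - c - l)) / (c^2 f). Both terms of the numerator are
    O(N^2), and 1/f is bounded. *)
Lemma bigO2_inv c f l : c != 0 -> bigO 1 l -> bigO 2 (fun h => f h - c - l h) ->
  bigO 2 (fun h => (f h)^-1 - c^-1 + l h / c ^+ 2).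
Proof.
move=> c0 hl hf; have hf1 : bigO 1 (fun h => f h - c).
  apply: bigO_ext (bigOD (bigO_leq (isT : (1 <= 2)%N) hf) hl).
  by exists 1 => // h _; rewrite subrK.
have h1 : bigO 2 (fun h => l h * (f h - c) - c * (f h - c - l h)).
  exact: bigOD (bigOM hl hf1) (bigON (bigOZ c hf)).
have := bigOZ (c ^- 2) (bigOM (bigO_inv c0 hf1) h1).
apply: bigO_ext; apply: near0S (bigO1_near_neq0 c0 hf1) => h fh0.
by field; rewrite c0.
Qed.

End Asymptotics.

(** * Perturbation of critical points *)

Section CriticalPoints.
Variables (R : realType) (n : nat) (z : 'I_n -> R[i]).
Local Notation C := R[i].
Implicit Types h : 'I_n -> C.

Definition supnorm h : R := \big[Num.max/0]_(i < n) cabs (h i).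

Lemma supnorm_ge0 h : 0 <= supnorm h.
Proof. exact: bigmax_ge_id. Qed.

Lemma cabs_le_supnorm h i : cabs (h i) <= supnorm h.
Proof. exact: bigmax_sup (lexx _). Qed.

Lemma supnorm_le h (d : R) : 0 <= d -> (forall i, cabs (h i) <= d) -> supnorm h <= d.
Proof. by move=> d0 hd; apply: bigmax_le. Qed.

Lemma bigO_coord i : bigO supnorm 1 (fun h => h i).
Proof.
exists 1 => //; exists 1 => // h _.
by rewrite expr1 mul1r cabs_le_supnorm.
Qed.

Definition shifted h : {poly C} := \prod_(i < n) ('X - (z i + h i)%:P).

(* Differentiating \sum_i 1/(w - z_i) = 0 gives the derivative of the critical
   point w along h. *)
Definition crit_shift (w : C) h : C :=
  (\sum_i h i / (w - z i) ^+ 2) / \sum_i (w - z i)^-1 ^+ 2.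

Lemma bigO_crit_shift w : bigO supnorm 1 (crit_shift w).
Proof.
have h1 : bigO supnorm 1 (fun h => \sum_i h i / (w - z i) ^+ 2).
  apply: bigO_sum => i; have := bigOZ ((w - z i) ^- 2) (bigO_coord i).
  by apply: bigO_ext; exists 1 => // h _; rewrite mulrC.
have := bigOZ (\sum_i (w - z i)^-1 ^+ 2)^-1 h1.
by apply: bigO_ext; exists 1 => // h _; rewrite mulrC.
Qed.

Lemma size_shifted h : size (shifted h) = n.+1.
Proof. by rewrite /shifted size_prod_XsubC [index_enum _]unlock -enumT size_enum_ord. Qed.

(** Let P = [shifted h] and x = w + [crit_shift w h]. Then P'/P = O(|h|^2) at x, while P''/P stays
    near -G, which is nonzero. The Newton step bound of [exists_near_root], applied to P', yields a
    zero of P' within O(|h|^2) of x. *)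
Lemma exists_critical_near (w : C) :
  (forall i, w != z i) -> \sum_i (w - z i)^-1 = 0 ->
  \sum_i (w - z i)^-1 ^+ 2 != 0 ->
  exists2 K, 0 <= K & near0 supnorm (fun h => exists2 v, root (shifted h)^`() v &
    cabs (v - w - crit_shift w h) <= K * supnorm h ^+ 2).
Proof.
set G := \sum_i _ ^+ 2 => wz F0 G0.
pose y i h := w + crit_shift w h - (z i + h i).
pose l i h := crit_shift w h - h i.
have l1 i : bigO supnorm 1 (l i).
  exact: bigOD (bigO_crit_shift w) (bigON (bigO_coord i)).
have c0 i : w - z i != 0 by rewrite subr_eq0.
have ye i h : y i h - (w - z i) = l i h by rewrite /y /l; ring.
have y1 i : bigO supnorm 1 (fun h => y i h - (w - z i)).
  by apply: bigO_ext (l1 i); exists 1 => // h _; rewrite ye.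
have y2 i : bigO supnorm 2 (fun h => y i h - (w - z i) - l i h).
  exists 0 => //; exists 1 => // h _.
  by rewrite ye subrr ComplexField.Normc.normc0 mul0r.
pose F h := \sum_i (y i h)^-1.
(* Expand each 1/y_i to first order. The constant terms add up to 0 by [F0], and the linear ones
   cancel by the choice of [crit_shift]. *)
have F2 : bigO supnorm 2 F.
  have := bigO_sum (index_enum 'I_n) (fun i => bigO2_inv supnorm_ge0 (c0 i) (l1 i) (y2 i)).
  apply: bigO_ext; exists 1 => // h _.
  rewrite big_split big_split sumrN /= F0 oppr0 addr0 -[RHS]addr0; congr (_ + _).
  transitivity (crit_shift w h * G - \sum_i h i / (w - z i) ^+ 2); last first.
    by rewrite /crit_shift -/G divfK // subrr.
  rewrite mulr_sumr -sumrB; apply: eq_bigr => i _.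
  by rewrite /l mulrBl exprVn.
pose S h := \sum_i (y i h)^-1 ^+ 2.
have hS : bigO supnorm 1 (fun h => S h - G).
  have h1 i : bigO supnorm 1 (fun h => (y i h)^-1 ^+ 2 - (w - z i)^-1 ^+ 2).
    have a1 := bigO1_inv supnorm_ge0 (c0 i) (y1 i).
    have a0 := bigOD (bigO_inv supnorm_ge0 (c0 i) (y1 i)) (bigO_cst supnorm (w - z i)^-1).
    by apply: bigO_ext (bigOM a1 a0); exists 1 => // h _; ring.
  apply: bigO_ext (bigO_sum (index_enum 'I_n) h1); exists 1 => // h _.
  by rewrite sumrB.
have D1 : bigO supnorm 1 (fun h => (F h ^+ 2 - S h) - (- G)).
  have := bigOD (bigO_leq supnorm_ge0 (isT : (1 <= 4)%N) (bigOM F2 F2)) (bigON hS).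
  by apply: bigO_ext; exists 1 => // h _; ring.
have NG : - G != 0 by rewrite oppr_eq0.
have hD := bigO1_near_half supnorm_ge0 NG D1.
have [K K0 hF] := F2.
have hG : 0 < cabs (- G) / 2 by rewrite divr_gt0 // cabs_gt0.
(* The numerator bounds (n - 1) |P'/P|, with n - 1 = deg P' rounded up to n; the denominator bounds
   |P''/P| from below. *)
exists (n%:R * K / (cabs (- G) / 2)).
  by rewrite divr_ge0 ?(ltW hG) ?mulr_ge0.
have hy := near0_forall (fun i => bigO1_near_neq0 supnorm_ge0 (c0 i) (y1 i)).
apply: near0S (near0I (near0I hD hF) hy) => h [[hDh hFh] hyh].
set x := w + crit_shift w h.
have xz : {in index_enum 'I_n, forall i, x != z i + h i}.
  by move=> i _; rewrite -subr_eq0; apply: hyh.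
have q1 := deriv_prod_XsubC xz; have q2 := deriv2_prod_XsubC xz.
rewrite -/(shifted h) -/(y _ h) in q1 q2.
set Q := (shifted h).[x] in q1 q2.
have Q0 : Q != 0.
  rewrite /Q horner_prod; apply/prodf_neq0 => i _.
  by rewrite hornerXsubC subr_eq0 xz ?mem_index_enum.
have q20 : (shifted h)^`()^`().[x] != 0.
  rewrite q2 mulf_neq0 // -cabs_gt0; apply: lt_le_trans hDh.
  exact: hG.
have [v qv hv] := exists_near_root q20; exists v => //.
move: hv; rewrite q1 [_^`()^`().[x]]q2 !cabsM size_deriv size_shifted /=.
have -> : \sum_i (x - (z i + h i))^-1 = F h by [].
have -> : \sum_i (x - (z i + h i))^-1 ^+ 2 = S h by [].
rewrite mulrCA [X in _ <= X]mulrCA ler_pM2l ?cabs_gt0 // => hv.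
rewrite -addrA -opprD -/x cabsBC mulrAC ler_pdivlMr //.
apply: le_trans (ler_wpM2l (cabs_ge0 _) hDh) _; apply: le_trans hv _.
by rewrite -mulrA ler_pM ?cabs_ge0 // ler_nat leq_pred.
Qed.

(** The w_j are distinct, so for small h the zeros of P' found near them are distinct too. There are
    n - 1 of them, the degree of P', so they are all its zeros. *)
Lemma all_critical_near (w : 'I_n.-1 -> C) : injective w -> (0 < n)%N ->
  (forall j i, w j != z i) -> (forall j, \sum_i (w j - z i)^-1 = 0) ->
  (forall j, \sum_i (w j - z i)^-1 ^+ 2 != 0) ->
  exists2 K, 0 <= K & near0 supnorm (fun h => exists v : 'I_n.-1 -> C,
    [/\ forall j, root (shifted h)^`() (v j),
        forall x, root (shifted h)^`() x -> exists j, x = v j &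
        forall j, cabs (v j - w j - crit_shift (w j) h) <= K * supnorm h ^+ 2]).
Proof.
move=> w_inj n0 wz w0 w2.
have hj j := exists_critical_near (wz j) (w0 j) (w2 j).
have [j k l kl|M M0 hM] := fin_bound _ hj.
  apply: near0S => h [v qv hv]; exists v => //; apply: le_trans hv _.
  by rewrite ler_wpM2r ?sqr_ge0.
have [A A0 hA] := bigO_fin supnorm_ge0 (fun j => bigO_crit_shift (w j)).
(* Each v_j stays within (A + M) |h| of w_j, so a gap above twice this keeps the v_j apart. *)
have far : near0 supnorm (fun h => forall jk : 'I_n.-1 * 'I_n.-1, jk.1 != jk.2 ->
    2 * (A + M) * supnorm h < cabs (w jk.1 - w jk.2)).
  apply: near0_forall => -[j k] /=; have [->|jk] := eqVneq j k; first by exists 1.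
  have wjk : 0 < cabs (w j - w k) by rewrite cabs_gt0 subr_eq0 (inj_eq w_inj).
  by apply: near0S (near0_small supnorm_ge0 (2 * (A + M)) wjk).
exists M => //.
apply: near0S (near0I (near0I (near0_le1 supnorm) far) (near0I hA (near0_forall hM))).
move=> h [[h1 hfar] [{}hA {}hM]].
have [v hv] : exists v : 'I_n.-1 -> C, forall j, root (shifted h)^`() (v j) /\
    cabs (v j - w j - crit_shift (w j) h) <= M * supnorm h ^+ 2.
  apply: (@fin_all_exists _ _ (fun j (x : C) => root (shifted h)^`() x /\
    cabs (x - w j - crit_shift (w j) h) <= M * supnorm h ^+ 2)) => j.
  by have [x hx hx'] := hM j; exists x.
have near j : cabs (v j - w j) <= (A + M) * supnorm h.
  have := ler_cabsD (v j - w j - crit_shift (w j) h) (crit_shift (w j) h).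
  rewrite subrK => /le_trans; apply; rewrite addrC mulrDl lerD //.
  apply: le_trans (proj2 (hv j)) _; rewrite ler_wpM2l // expr2.
  by rewrite ler_piMl ?supnorm_ge0.
have v_inj : injective v.
  move=> j k vjk; apply/eqP; apply: contraT => jk; have := hfar (j, k) jk.
  rewrite ltNge /= => /negP[]; apply: le_trans (ler_cabs_dist _ (v j) _) _.
  by rewrite cabsBC {2}vjk; have := near j; have := near k; lra.
exists v; split=> [j|x qx|j]; try by case: (hv j).
case: (boolP (x \in codom v)) => [/codomP//|xv].
have q'0 : (shifted h)^`() != 0.
  rewrite -size_poly_gt0 size_deriv size_shifted; by case: (n) n0.
(* A further zero x would give P' at least n distinct zeros. *)
have := max_poly_roots q'0 (rs := x :: codom v).
rewrite /= qx xv map_inj_uniq ?enum_uniq // size_codom card_ord.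
rewrite size_deriv size_shifted /= prednK // ltnn => hroots.
suff : false by []. apply: hroots => //.
by apply/allP => y /codomP[j ->]; case: (hv j).
Qed.

End CriticalPoints.

(** * The extremal zero *)

(** If q and q' both vanish at x, then (X - x)^2 divides q, against multiplicity one. *)
Lemma simple_zeros_deriv (R : realType) (q : {poly R[i]}) x :
  q != 0 -> simple_zeros q -> root q x -> q^`().[x] != 0.
Proof.
move=> q0 hq qx; apply/negP => q'x; have /eqP := hq x qx.
have /factor_theorem[s qs] := qx.
move: q'x; rewrite qs derivM derivXsubC mulr1 hornerD hornerM hornerXsubC.
rewrite subrr mulr0 add0r => /factor_theorem[s' ss'].
have s'0 : s' * ('X - x%:P) * ('X - x%:P) != 0 by rewrite -ss' -qs.
move: (s'0); rewrite !mulf_eq0 !negb_or => /andP[/andP[s'0' X0] _].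
by rewrite ss' !mupM ?mulf_neq0 // -[mup x ('X - _)]/(mup x (('X - x%:P) ^+ 1))
  !mup_XsubCX eqxx addn1 addn1.
Qed.

(** Gordan's theorem is applied to the real parts of the rows, as real functionals on C^n;
    [Rcomplex] supplies the real vector space structure. *)
Lemma complex_gordan (R : realType) (m n : nat) (M : 'M[R[i]]_(m, n)) :
  ~ positively_singular M ->
  exists h : 'I_n -> R[i], forall i, 0 < complex.Re (\sum_j M i j * h j).
Proof.
move=> singM.
pose f i (h : {ffun 'I_n -> Rcomplex R}) : R :=
  complex.Re (\sum_j M i j * (h j : R[i])).
have f_lin i s x y : f i (x + s *: y) = f i x + s * f i y.
  rewrite /f -Re_scale -ReD mulr_sumr -big_split /=; congr complex.Re.
  apply: eq_bigr => j _; rewrite mulrCA -mulrDr; congr (_ * _).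
  rewrite !ffunE; case: (x j) (y j) => [a b] [c e].
  by congr Complex; rewrite /= ?mul0r ?subr0 ?addr0.
have [[mu [mu0 mui mu_sum]]|[h hpos]] := gordan f_lin; last by exists h.
case: singM; exists mu; split=> // j; set S := \sum_i _.
(* Let S be the combination of column j. Testing on the vector with entry conj S at j and 0
   elsewhere yields |S|^2 = 0, so the vanishing of real parts gives that of the complex column
   sum. *)
have := mu_sum [ffun k => if k == j then conjc S else 0].
rewrite /f; under eq_bigr => i _.
  rewrite (bigD1 j) //= big1 => [|k kj]; last by rewrite ffunE (negPf kj) mulr0.
  rewrite ffunE eqxx addr0 -Re_scale mulrA; over.
rewrite -Re_sum -mulr_suml -/S => /eqP.
have -> : complex.Re (S * conjc S) = cabs S ^+ 2.
  by rewrite sqr_cabs; case: (S) => a b /=; ring.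
by rewrite expf_eq0 /= cabs_eq0 => /eqP.
Qed.

Lemma near0_scale (R : realType) (n : nat) (h : 'I_n -> R[i]) P :
  near0 (@supnorm R n) P -> near0 (@Num.norm R R) (fun t => P (fun i => t%:C * h i)).
Proof.
move=> [e e0 he]; have H0 : 0 < 1 + supnorm h by rewrite ltr_pwDl ?supnorm_ge0.
exists (e / (1 + supnorm h)) => [|t]; first by rewrite divr_gt0.
rewrite ler_pdivlMr // => ht; apply: he; apply: supnorm_le => [|i]; first exact: ltW.
apply: le_trans ht; rewrite cabsM cabs_real ler_wpM2l //.
by apply: le_trans (cabs_le_supnorm h i) _; rewrite lerDr.
Qed.

Lemma near0_powR (R : realType) (B k e : R) : 0 < k -> 0 < e ->
  near0 (@Num.norm R R) (fun t => 0 <= t -> B * t `^ k < e).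
Proof.
move=> k0 e0; have B0 : 0 < 1 + `|B| by rewrite ltr_pwDl.
pose e' := e / (1 + `|B|) / 2; have e'0 : 0 < e' by rewrite !divr_gt0.
exists (e' `^ k^-1); first by rewrite powR_gt0.
move=> t ht t0; rewrite ger0_norm // in ht.
have : t `^ k <= e'.
  rewrite -[leRHS](powRr1 (ltW e'0)) -(mulVf (lt0r_neq0 k0)) powRrM.
  by apply: ge0_ler_powR => //; rewrite ?ltW // nnegrE ?powR_ge0.
move=> hk; apply: le_lt_trans (_ : `|B| * e' < e).
  apply: le_trans (ler_wpM2r (powR_ge0 _ _) (ler_norm B)) _.
  by rewrite ler_wpM2l.
rewrite /e' mulrA ltr_pdivrMr // mulrA ltr_pdivrMr //.
have := normr_ge0 B; nra.
Qed.

(** * First order variation of d(p) and the equivalence *)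

Section LinearInextensibility.
Variables (R : realType) (n : nat) (p : {poly R[i]}).
Variables (z : n.-tuple R[i]) (r : nat) (w : n.-1.-tuple R[i]).
Local Notation C := R[i].
Hypothesis hn : (3 <= n)%N.
Hypothesis hp : inS n p.
Hypothesis hz : labels_zeros p z.
Hypothesis ha : critdist p z`_0 = maxdist p.
Hypothesis hsimple : simple_zeros p.
Hypothesis hsimple' : simple_zeros p^`().
Hypothesis hlt : forall i : nat, (0 < i < n)%N -> critdist p z`_i < maxdist p.
Hypothesis hw : labels_critical_points r p z`_0 w.

Let d := maxdist p.

Lemma n_gt0 : (0 < n)%N.
Proof. exact: leq_trans hn. Qed.

Let i0 : 'I_n := Ordinal n_gt0.

Lemma p_neq0 : p != 0.
Proof. by case: hp => p1 _ _; rewrite monic_neq0. Qed.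

Lemma root_label (i : 'I_n) : root p z`_i.
Proof.
by rewrite /root hz horner_prod (bigD1 i) //= hornerXsubC subrr mul0r.
Qed.

Lemma natn_neq0 : n%:R != 0 :> C.
Proof. by rewrite pnatr_eq0 -lt0n n_gt0. Qed.

Lemma root_crit (j : 'I_n.-1) : root p^`() w`_j.
Proof.
case: hw => -> _ _ _; rewrite rootZ ?natn_neq0 //.
by rewrite /root horner_prod (bigD1 j) //= hornerXsubC subrr mul0r.
Qed.

Lemma crit_label x : root p^`() x -> exists j : 'I_n.-1, x = w`_j.
Proof.
case: hw => -> _ _ _; rewrite rootZ ?natn_neq0 // /root horner_prod.
by case/prodf_eq0 => j _; rewrite hornerXsubC subr_eq0 => /eqP; exists j.
Qed.

Lemma deriv_neq0 : p^`() != 0.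
Proof.
rewrite -size_poly_eq0 size_deriv; case: hp => _ -> _ /=.
by rewrite -lt0n n_gt0.
Qed.

Lemma zeros_nroot x : root p^`() x -> ~~ root p x.
Proof.
by apply: contraL => /(simple_zeros_deriv p_neq0 hsimple).
Qed.

Lemma crit_neq_zero (j : 'I_n.-1) (i : 'I_n) : w`_j != z`_i.
Proof.
by apply: contraNneq (zeros_nroot (root_crit j)) => ->; apply: root_label.
Qed.

Lemma crit_inj : injective (fun j : 'I_n.-1 => w`_j).
Proof.
move=> j k /= wjk; apply/eqP; apply: contraT => jk.
have := simple_zeros_deriv deriv_neq0 hsimple' (root_crit j).
case: hw => -> _ _ _; rewrite (bigD1 j) //= (bigD1 k) 1?eq_sym //= -wjk.
by rewrite derivZ !derivM !derivXsubC !hornerE subrr !(mul0r, mulr0, addr0) eqxx.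
Qed.

Lemma sum_inv_crit (j : 'I_n.-1) : \sum_(i < n) (w`_j - z`_i)^-1 = 0.
Proof.
have hx : {in index_enum 'I_n, forall i : 'I_n, w`_j != z`_i}.
  by move=> i _; apply: crit_neq_zero.
have := deriv_prod_XsubC hx; rewrite -hz => /esym/eqP.
rewrite (rootP (root_crit j)) mulf_eq0 => /orP[pw|/eqP//].
by have := zeros_nroot (root_crit j); rewrite /root pw.
Qed.

(** This replaces p(w)/p''(w) in [alpha] by -1/G, where G is the denominator of [crit_shift]. *)
Lemma deriv2_crit (j : 'I_n.-1) :
  p^`(2).[w`_j] = - p.[w`_j] * \sum_(i < n) (w`_j - z`_i)^-1 ^+ 2.
Proof.
have hx : {in index_enum 'I_n, forall i : 'I_n, w`_j != z`_i}.
  by move=> i _; apply: crit_neq_zero.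
have := deriv2_prod_XsubC hx; rewrite -hz => ->.
by rewrite sum_inv_crit expr0n sub0r mulrN mulNr.
Qed.

Lemma deriv2_crit_neq0 (j : 'I_n.-1) : p^`(2).[w`_j] != 0.
Proof. exact: simple_zeros_deriv deriv_neq0 hsimple' (root_crit j). Qed.

Lemma sum_sqr_inv_crit (j : 'I_n.-1) : \sum_(i < n) (w`_j - z`_i)^-1 ^+ 2 != 0.
Proof.
by have := deriv2_crit_neq0 j; rewrite deriv2_crit mulf_eq0 negb_or => /andP[].
Qed.

(* The differential of log (w_j - a) in the zeros of p. *)
Definition dlog (j : 'I_n.-1) (h : 'I_n -> C) : C :=
  \sum_(i < n) alpha p z w`_j i * h i.

Let zf (i : 'I_n) := z`_i.

(** To first order, w_j moves by [crit_shift] and the distinguished zero by [h i0]. Hence row j of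
    the matrix records the relative change of w_j - a. *)
Lemma dlogE (j : 'I_n.-1) (h : 'I_n -> C) :
  (w`_j - z`_0) * dlog j h = crit_shift zf w`_j h - h i0.
Proof.
have wz (i : 'I_n) : w`_j - z`_i != 0 by rewrite subr_eq0 crit_neq_zero.
rewrite /crit_shift /zf; move: (sum_sqr_inv_crit j) (deriv2_crit j).
set G := \sum_i _ => G0 p2.
have pw : p.[w`_j] != 0 by exact: zeros_nroot (root_crit j).
rewrite /dlog (bigD1 i0) //= [in RHS](bigD1 i0) //= {1}/alpha /=.
have -> : \sum_(i < n | i != i0) alpha p z w`_j i * h i =
    ((w`_j - z`_0) * G)^-1 * \sum_(i < n | i != i0) h i / (w`_j - z`_i) ^+ 2.
  rewrite mulr_sumr; apply: eq_bigr => i ii0; rewrite /alpha ifN ?p2.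
    by field; rewrite G0 pw wz (wz i0).
  by apply: contra ii0 => /eqP i00; apply/eqP/val_inj.
by rewrite p2; field; rewrite G0 pw (wz i0).
Qed.

Lemma bigO_dlog (j : 'I_n.-1) : bigO (@supnorm R n) 1 (dlog j).
Proof.
by apply: bigO_sum => i; apply: bigOZ; apply: bigO_coord.
Qed.

(** The new difference is (w_j - a)(1 + dlog) + O(|h|^2), and |1 + x| = 1 + Re x + O(|x|^2). *)
Lemma perturbed_critical_distances : exists2 K, 0 <= K &
  near0 (@supnorm R n) (fun h => exists v : 'I_n.-1 -> C,
    [/\ forall j, root (shifted zf h)^`() (v j),
        forall x, root (shifted zf h)^`() x -> exists j, x = v j,
        forall j, cabs (v j - w`_j) <= K * supnorm h &
        forall j, `|cabs (v j - (z`_0 + h i0)) -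
                    cabs (w`_j - z`_0) * (1 + complex.Re (dlog j h))| <=
                  K * supnorm h ^+ 2]).
Proof.
have [K K0 hK] := all_critical_near (z := zf) crit_inj n_gt0 crit_neq_zero
  sum_inv_crit sum_sqr_inv_crit.
have [A A0 hA] := bigO_fin (@supnorm_ge0 R n) bigO_dlog.
have [B B0 hB] := bigO_fin (@supnorm_ge0 R n)
  (fun j : 'I_n.-1 => bigO_crit_shift zf w`_j).
have [D D0 hD] : exists2 D, 0 <= D & forall j : 'I_n.-1, cabs (w`_j - z`_0) <= D.
  apply: fin_bound => [j k l kl|j]; first by move/le_trans; apply.
  by exists (cabs (w`_j - z`_0)); rewrite ?cabs_ge0.
(* K + B controls the motion of v_j and K + D A^2 the quadratic error; one constant serves both. *)
exists (K + B + 2 * K + D * (A ^+ 2)).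
  by rewrite !addr_ge0 ?mulr_ge0 // sqr_ge0.
have half_gt0 : 0 < 2^-1 :> R by rewrite invr_gt0.
have small := near0_small (@supnorm_ge0 R n) A half_gt0.
apply: near0S (near0I (near0I small (near0_le1 (@supnorm R n)))
  (near0I hK (near0I hA hB))).
move=> h [[{}small N1] [[v [vr rv hv]] [{}hA {}hB]]].
have N0 := supnorm_ge0 h; set N := supnorm h in hv hA hB small N1 N0 *.
have N2 : N ^+ 2 <= N by rewrite expr2 ler_piMl.
exists v; split=> // j.
  have := ler_cabsD (v j - w`_j - crit_shift zf w`_j h) (crit_shift zf w`_j h).
  rewrite subrK => /le_trans; apply.
  have := hv j; have := hB j; rewrite expr1 => h1 h2.
  apply: le_trans (lerD h2 h1) _.
  have := ler_wpM2l K0 N2; have : 0 <= (2 * K + D * A ^+ 2) * N.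
    by rewrite mulr_ge0 ?addr_ge0 ?mulr_ge0 ?sqr_ge0.
  lra.
set c := w`_j - z`_0.
set e := v j - w`_j - crit_shift zf w`_j h.
have -> : v j - (z`_0 + h i0) = c * (1 + dlog j h) + e.
  by rewrite mulrDr mulr1 dlogE /e /c; ring.
have he : cabs e <= K * N ^+ 2 := hv j.
have := hA j; rewrite expr1 => hl.
have h1 := ler_cabsD (c * (1 + dlog j h)) e.
have h2 := ler_cabsB (c * (1 + dlog j h)) (- e).
rewrite opprK cabsN in h2; rewrite cabsM in h1 h2.
have g1 := cabs_addl1_ge (dlog j h).
have g2 := cabs_addl1_le (le_trans hl (ltW small)).
have c0 := cabs_ge0 c.
have g1' := ler_wpM2l c0 g1; have g2' := ler_wpM2l c0 g2.
have g3 : cabs c * cabs (dlog j h) ^+ 2 <= D * A ^+ 2 * N ^+ 2.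
  rewrite -mulrA -exprMn ler_pM ?sqr_ge0 // ?hD // ler_sqr ?nnegrE ?cabs_ge0 //.
  by rewrite mulr_ge0.
have BN : 0 <= (B + 2 * K) * N ^+ 2 by rewrite mulr_ge0 ?sqr_ge0 ?addr_ge0 ?mulr_ge0.
have AN : 0 <= D * A ^+ 2 * N ^+ 2 by rewrite !mulr_ge0 ?sqr_ge0.
rewrite ler_norml; apply/andP; split; lra.
Qed.


Lemma r_le : (r <= n.-1)%N.
Proof. by case: hw => _ /andP[_ rn] _ _; rewrite -ltnS (prednK n_gt0). Qed.

Let near_crit (k : 'I_r) : 'I_n.-1 := widen_ord r_le k.

Lemma cabs_near_crit (k : 'I_r) : cabs (w`_(near_crit k) - z`_0) = d.
Proof. by case: hw => _ _ h _; rewrite /d -ha (h (near_crit k)) /=. Qed.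

Lemma cabs_far_crit (j : 'I_n.-1) : (r <= j)%N -> d < cabs (w`_j - z`_0).
Proof. by case: hw => _ _ _ h /h; rewrite /d -ha. Qed.

Lemma d_gt0 : 0 < d.
Proof.
have r0 : (0 < r)%N by case: hw => _ /andP[].
rewrite -(cabs_near_crit (Ordinal r0)) cabs_gt0 subr_eq0.
exact: crit_neq_zero (near_crit (Ordinal r0)) i0.
Qed.

Lemma shifted_root (h : 'I_n -> C) (i : 'I_n) : root (shifted zf h) (z`_i + h i).
Proof.
by rewrite /root /shifted horner_prod (bigD1 i) //= hornerXsubC subrr mul0r.
Qed.

Lemma shifted_rootP (h : 'I_n -> C) x :
  root (shifted zf h) x -> exists i : 'I_n, x = z`_i + h i.
Proof.
rewrite /root /shifted horner_prod => /prodf_eq0[i _].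
by rewrite hornerXsubC subr_eq0 => /eqP; exists i.
Qed.

Lemma shifted_neq0 (h : 'I_n -> C) : shifted zf h != 0.
Proof. by rewrite monic_neq0 // monic_prod_XsubC. Qed.

Lemma deriv_shifted_neq0 (h : 'I_n -> C) : (shifted zf h)^`() != 0.
Proof. by rewrite -size_poly_eq0 size_deriv size_shifted -lt0n n_gt0. Qed.

(** The strict gap in [hlt] absorbs any first order change, so the other zeros cannot reach the
    value d(p) for small h. *)
Lemma other_zeros_near (K : R) : near0 (@supnorm R n) (fun h =>
  forall i : 'I_n, i != i0 -> critdist p z`_i + K * supnorm h < d).
Proof.
apply: near0_forall => i; have [->|ii0] := eqVneq i i0; first by exists 1.
have hi : 0 < d - critdist p z`_i.
  rewrite subr_gt0 /d hlt // ltn_ord andbT lt0n.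
  by apply: contra ii0 => /eqP i00; apply/eqP/val_inj.
by apply: near0S (near0_small (@supnorm_ge0 R n) K hi) => h + _; rewrite ltrBrDl.
Qed.

Lemma Amatrix_near (k : 'I_r) h :
  \sum_j Amatrix r p z w (lshift _ k) j * h j = dlog (near_crit k) h.
Proof. by apply: eq_bigr => j _; rewrite col_mxEu mxE. Qed.

Lemma Amatrix_boundary (k : 'I_#|unimodular z|) h :
  \sum_j Amatrix r p z w (rshift _ k) j * h j =
  - conjc z`_(enum_val k) * h (enum_val k).
Proof.
rewrite (bigD1 (enum_val k)) //= big1 ?addr0 => [|j jk]; rewrite col_mxEd mxE.
  by rewrite eqxx.
by rewrite (negPf jk) mul0r.
Qed.

Lemma sqr_cabs_shift (x y : C) :
  cabs (x + y) ^+ 2 = cabs x ^+ 2 - 2 * complex.Re (- conjc x * y) + cabs y ^+ 2.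
Proof. by rewrite !sqr_cabs; case: x y => [a b] [c e] /=; ring. Qed.

Lemma cabs_unimodular (k : 'I_#|unimodular z|) : cabs z`_(enum_val k) = 1.
Proof. by apply/eqP; have := enum_valP k; rewrite inE. Qed.

(** Expanding |z + h|^2 <= 1 with |z| = 1 gives 2 Re(-conj z h) >= |h|^2. The inequality is exact,
    so no error term enters from the boundary rows. *)
Lemma feasible_boundary (h : 'I_n -> C) (k : 'I_#|unimodular z|) :
  cabs (z`_(enum_val k) + h (enum_val k)) <= 1 ->
  0 <= complex.Re (- conjc z`_(enum_val k) * h (enum_val k)).
Proof.
move=> hk; have := sqr_cabs_shift z`_(enum_val k) (h (enum_val k)).
have := sqr_ge0 (cabs (h (enum_val k))).
have : cabs (z`_(enum_val k) + h (enum_val k)) ^+ 2 <= 1.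
  by rewrite expr_le1 ?cabs_ge0.
rewrite cabs_unimodular; lra.
Qed.

(** If all Re(dlog) were positive, the vanishing combination would be a sum of nonnegative terms,
    forcing the weights of the critical rows to be 0. The boundary rows alone admit no nontrivial
    vanishing combination. *)
Lemma exists_dlog_le0 : positively_singular (Amatrix r p z w) ->
  forall h : 'I_n -> C, (forall i : 'I_n, cabs (z`_i + h i) <= 1) ->
  exists k : 'I_r, complex.Re (dlog (near_crit k) h) <= 0.
Proof.
move=> [mu [mu0 [i mui] mu_sum]] h hh.
case: (boolP [exists k : 'I_r, complex.Re (dlog (near_crit k) h) <= 0]).
  by move/existsP.
rewrite negb_exists => /forallP hpos.
have sum0 : \sum_k mu (lshift _ k) * complex.Re (dlog (near_crit k) h) +
    \sum_k mu (rshift _ k) * complex.Re (- conjc z`_(enum_val k) * h (enum_val k)) = 0.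
  transitivity (complex.Re (\sum_j (\sum_i (mu i)%:C * Amatrix r p z w i j) * h j)).
    2: by rewrite big1 // => j _; rewrite mu_sum mul0r.
  under [in RHS]eq_bigr => j _ do rewrite mulr_suml.
  rewrite exchange_big /= Re_sum big_split_ord /=; congr (_ + _).
    apply: eq_bigr => k _; rewrite -Re_scale -Amatrix_near mulr_sumr.
    by congr complex.Re; apply: eq_bigr => j _; rewrite mulrA.
  apply: eq_bigr => k _; rewrite -Re_scale -Amatrix_boundary mulr_sumr.
  by congr complex.Re; apply: eq_bigr => j _; rewrite mulrA.
have near0k k : 0 <= mu (lshift _ k) * complex.Re (dlog (near_crit k) h).
  by rewrite mulr_ge0 // ltW // ltNge hpos.
have far0k k : 0 <= mu (rshift _ k) *
    complex.Re (- conjc z`_(enum_val k) * h (enum_val k)).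
  by rewrite mulr_ge0 // feasible_boundary.
move/eqP: sum0; rewrite paddr_eq0 ?sumr_ge0 // => /andP[/eqP s1 _].
have muL k : mu (lshift _ k) = 0.
  have /eqP : mu (lshift _ k) * complex.Re (dlog (near_crit k) h) = 0.
    exact: (psumr_eq0P (fun k _ => near0k k) s1).
  rewrite mulf_eq0 => /orP[/eqP//|/eqP dk0].
  by have := hpos k; rewrite dk0 lexx.
(* Boundary rows are supported in distinct columns, and their single entries have modulus 1. *)
have muR k : mu (rshift _ k) = 0.
  have := mu_sum (enum_val k); rewrite big_split_ord /= big1 ?add0r => [|l _].
    rewrite (bigD1 k) //= big1 ?addr0 => [|l lk]; last first.
      by rewrite col_mxEd mxE (inj_eq enum_val_inj) eq_sym (negPf lk) mulr0.
    rewrite col_mxEd mxE eqxx => /eqP; rewrite mulf_eq0 => /orP[/eqP[]//|].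
    move=> /eqP zk0; have := cabs_unimodular k.
    have -> : z`_(enum_val k) = 0.
      by apply/eqP; rewrite -conjc_eq0 -oppr_eq0 zk0.
    by rewrite ComplexField.Normc.normc0 => /eqP; rewrite eq_sym oner_eq0.
  by rewrite muL mul0r.
by move: mui; case: (split_ordP i) => k ->; rewrite ?muL ?muR eqxx.
Qed.

Lemma inextensible_of_positively_singular : positively_singular (Amatrix r p z w) ->
  linearly_inextensible n p.
Proof.
move=> hA; have [K K0 hK] := perturbed_critical_distances.
(* A zero moves by at most |h| and a critical point by at most K |h|, hence the factor 1 + K. *)
have [eps eps0 heps] := near0I hK (other_zeros_near (1 + K)).
(* The exponent kappa = 1 reflects the quadratic error of the expansion. *)
exists eps, K, 1; split=> // q [q1 sq qroots] Dq.
have [h [hq hh]] := Delta_shift zf sq q1.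
have {}hq : q = shifted zf h by [].
have pz : p = \prod_(i < n) ('X - (zf i)%:P) by [].
rewrite -pz in hh; set D := Delta n q p in Dq hh *.
have D0 : 0 <= D := Delta_ge0 n q p.
have ND : supnorm h <= D := supnorm_le D0 hh.
have N0 := supnorm_ge0 h.
have [[v [vroot rootv vw hdist]] hother] := heps h (le_trans ND (ltW Dq)).
have -> : D `^ (1 + 1) = D ^+ 2 by rewrite -[1 + 1]/(2%:R) powR_mulrn.
have KD : 0 <= K * D ^+ 2 by rewrite mulr_ge0 ?sqr_ge0.
rewrite -/d hq; apply: maxdist_le; first exact: shifted_neq0.
  by rewrite addr_ge0 // ltW // d_gt0.
move=> x /shifted_rootP[i ->]; have [->|ii0] := eqVneq i i0.
  have [i'|k hk] := exists_dlog_le0 hA (h := h).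
    by apply: qroots; rewrite hq shifted_root.
  apply: le_trans (critdist_le _ (deriv_shifted_neq0 h) (vroot (near_crit k))) _.
  rewrite cabsBC; have := hdist (near_crit k); rewrite ler_norml => /andP[_].
  rewrite cabs_near_crit => h1.
  have h2 := ler_wpM2l (ltW d_gt0) hk; rewrite mulr0 in h2.
  have h3 : K * supnorm h ^+ 2 <= K * D ^+ 2.
    by rewrite ler_wpM2l // ler_sqr ?nnegrE.
  by rewrite /= in h1 *; lra.
have sp : (2 < size p)%N by case: hp => _ -> _; apply: leqW.
have [y py hy] := critdist_attained z`_i sp.
have [j yj] := crit_label py; have hi := hother i ii0.
apply: le_trans (critdist_le _ (deriv_shifted_neq0 h) (vroot j)) _.
have h1 := ler_cabs_dist (z`_i + h i) z`_i (v j).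
have h2 := ler_cabs_dist z`_i w`_j (v j).
have h3 := cabs_le_supnorm h i.
have h4 := vw j; rewrite cabsBC in h4.
rewrite hy yj in hi; rewrite [z`_i + h i]addrC addrK addrC in h1.
rewrite mulrDl mul1r in hi; lra.
Qed.


(** Zeros inside the open disk have room to move. On the circle, |z + t h|^2 = 1 - 2tc + t^2 |h|^2
    with c > 0, which is at most 1 once t |h|^2 <= 2c. *)
Lemma near0_feasible (h : 'I_n -> C) :
  (forall k : 'I_#|unimodular z|,
     0 < complex.Re (- conjc z`_(enum_val k) * h (enum_val k))) ->
  near0 (@Num.norm R R) (fun t => forall i : 'I_n, 0 <= t ->
    cabs (z`_i + t%:C * h i) <= 1).
Proof.
move=> hk; apply: near0_forall => i.
have zi1 : cabs z`_i <= 1 by case: hp => _ _; apply; apply: root_label.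
have [iu|iu] := boolP (i \in unimodular z); last first.
  have zi : 0 < 1 - cabs z`_i.
    by rewrite subr_gt0 lt_neqAle zi1 andbT; move: iu; rewrite inE.
  apply: near0S (near0_small (@normr_ge0 R R) (cabs (h i)) zi) => t ht t0.
  have := ler_cabsD z`_i (t%:C * h i); rewrite cabsM cabs_real.
  by rewrite mulrC in ht; lra.
have := hk (enum_rank_in iu i); rewrite enum_rankK_in //.
set c := complex.Re _ => c0; have c20 : 0 < 2 * c by rewrite mulr_gt0.
apply: near0S (near0_small (@normr_ge0 R R) (cabs (h i) ^+ 2) c20) => t ht t0.
rewrite ger0_norm // in ht.
rewrite -(expr_le1 (isT : (0 < 2)%N)) ?cabs_ge0 // sqr_cabs_shift.
have -> : cabs z`_i = 1 by apply/eqP; move: iu; rewrite inE.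
rewrite mulrCA Re_scale -/c cabsM cabs_real ger0_norm // exprMn.
have := ler_wpM2l t0 (ltW ht); nra.
Qed.

Lemma dlogZ j (t : R) h : dlog j (fun i => t%:C * h i) = t%:C * dlog j h.
Proof. by rewrite /dlog mulr_sumr; apply: eq_bigr => i _; rewrite mulrCA. Qed.

Lemma positively_singular_of_inextensible : linearly_inextensible n p ->
  positively_singular (Amatrix r p z w).
Proof.
move=> [eps [B [k [eps0 B0 k0 hq]]]]; apply: contrapT => /complex_gordan[h hpos].
have dpos (l : 'I_r) : 0 < d * complex.Re (dlog (near_crit l) h).
  by rewrite mulr_gt0 ?d_gt0 // -Amatrix_near hpos.
(* A common rate c: each nearest critical distance grows along h with slope above c. *)
have [c c0 hc] := exists_small_pos (fun=> -1) dpos.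
have bpos (l : 'I_#|unimodular z|) :
    0 < complex.Re (- conjc z`_(enum_val l) * h (enum_val l)).
  by rewrite -Amatrix_boundary hpos.
pose H := 1 + supnorm h; have H0 : 0 < H by rewrite ltr_pwDl ?supnorm_ge0.
have c20 : 0 < c / 2 by rewrite divr_gt0.
have [K K0 hK] := perturbed_critical_distances.
(* The remaining critical points start strictly farther than d(p), so for small t their distances
   also exceed d + tc. *)
have far : near0 (@Num.norm R R) (fun t => forall j : 'I_n.-1, (r <= j)%N -> 0 <= t ->
    d + t * c <= cabs (w`_j - z`_0) * (1 + t * complex.Re (dlog j h))).
  apply: near0_forall => j; have [jr|rj] := ltnP j r; first by exists 1.
  have hj : 0 < cabs (w`_j - z`_0) - d by rewrite subr_gt0 cabs_far_crit.
  apply: near0S (near0_small (@normr_ge0 R R)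
    (c - cabs (w`_j - z`_0) * complex.Re (dlog j h)) hj) => t ht _ t0.
  by rewrite ger0_norm // in ht; lra.
(* Choose t so small that the expansion error K (tH)^2 and the allowed growth B (tH)^(1+k) are each
   below tc/2. Then d + tc - K (tH)^2 <= d(q) <= d + B (tH)^(1+k) is contradictory. *)
have [t t0 ht] := near0I (near0I (near0_scale h hK) (near0_feasible bpos))
  (near0I far (near0I (near0_small (@normr_ge0 R R) H eps0)
  (near0I (near0_small (@normr_ge0 R R) (K * H ^+ 2) c20)
          (near0_powR (B * H * H `^ k) k0 c20)))).
have := ht t; rewrite (ger0_norm (ltW t0)) => /(_ (lexx _)).
move=> [[[v [vr rv _ hdist]] hfeas] [{}far [tH [tK tpow]]]].
have {}tpow := tpow (ltW t0).
set th := fun i => t%:C * h i in vr rv hdist.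
have Nth : supnorm th <= t * H.
  apply: supnorm_le => [|i]; first by rewrite mulr_ge0 // ltW.
  rewrite cabsM cabs_real ger0_norm ?(ltW t0) // ler_pM2l //.
  by apply: le_trans (cabs_le_supnorm h i) _; rewrite lerDr.
have Sq : inS n (shifted zf th).
  split; [exact: monic_prod_XsubC | exact: size_shifted |].
  by move=> x /shifted_rootP[i ->]; apply: hfeas (ltW t0).
have tH0 : 0 <= t * H by rewrite mulr_ge0 // ltW.
have Dq : Delta n (shifted zf th) p <= t * H.
  have pz : p = \prod_(i < n) ('X - (zf i)%:P) by [].
  rewrite pz; apply: Delta_le => // i; rewrite [zf i + _]addrC addrK.
  exact: le_trans (cabs_le_supnorm th i) Nth.
have upper := hq _ Sq (le_lt_trans Dq _); rewrite mulrC in tH.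
have {}upper := upper tH.
have sq : (2 < size (shifted zf th))%N by rewrite size_shifted; apply: leqW.
have lower := maxdist_ge (shifted_neq0 th) (shifted_root th i0).
have [x xr hx] := critdist_attained (z`_i0 + th i0) sq.
have [j xj] := rv x xr; rewrite hx xj cabsBC in lower.
have := hdist j; rewrite ler_norml => /andP[+ _]; rewrite dlogZ Re_scale => h1.
have h2 : K * supnorm th ^+ 2 <= K * (t * H) ^+ 2.
  by rewrite ler_wpM2l // ler_sqr ?nnegrE ?supnorm_ge0.
have h3 : d + t * c <= cabs (w`_j - z`_0) * (1 + t * complex.Re (dlog j h)).
  have [jr|rj] := ltnP j r; last exact: far (ltW t0).
  have -> : j = near_crit (Ordinal jr) by apply: val_inj.
  rewrite cabs_near_crit; have := ler_wpM2l (ltW t0) (ltW (hc (Ordinal jr))).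
  by rewrite mulr0; lra.
have h4 : B * Delta n (shifted zf th) p `^ (1 + k) <= t * (B * H * H `^ k * t `^ k).
  have -> : t * (B * H * H `^ k * t `^ k) = B * (t * H) `^ (1 + k).
    rewrite powRD; last by rewrite mulf_neq0 ?lt0r_neq0 ?implybT.
    by rewrite powRr1 // powRM ?(ltW t0) ?(ltW H0) //; ring.
  rewrite ler_wpM2l //; apply: ge0_ler_powR => //; first by rewrite addr_ge0 // ltW.
  by rewrite nnegrE Delta_ge0.
have h5 := ltr_pM2l t0; rewrite -(h5 _ (c / 2)) in tpow.
rewrite -(h5 _ (c / 2)) in tK.
rewrite -/d in upper; rewrite /= in h1 lower; lra.
Qed.

End LinearInextensibility.

Theorem theorem4 (R : realType) (n : nat) (p : {poly R[i]})
    (z : n.-tuple R[i]) (r : nat) (w : n.-1.-tuple R[i])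
    (hn : (3 <= n)%N)
    (hp : inS n p)
    (hz : labels_zeros p z)
    (ha : critdist p z`_0 = maxdist p)
    (hsimple : simple_zeros p)
    (hsimple' : simple_zeros p^`())
    (hlt : forall i : nat, (0 < i < n)%N -> critdist p z`_i < maxdist p)
    (hw : labels_critical_points r p z`_0 w) :
  linearly_inextensible n p <-> positively_singular (Amatrix r p z w).
Proof.
split; first exact: positively_singular_of_inextensible.
exact: inextensible_of_positively_singular.
Qed.
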